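(* Let $X$ be a real Banach space and let $f:[a,b]\to X$ be such that $md(f,x)$ exists for every $x\in[a,b]$ and the function $md(f,\cdot)$ is continuous on $[a,b]$. Then the set of points of $[a,b]$ at which $f$ is not metrically differentiable is $\sigma$-symmetrically porous.
   Context: For $f:[a,b]\to X$, the unilateral metric derivatives are $md_{\pm}(f,x)=\lim_{t\to0+}\frac{\|f(x\pm t)-f(x)\|}{t}$. If both exist and are equal (and finite), their common value is the metric derivative $md(f,x)$; at an endpoint of $[a,b]$ only the one-sided limit taken inside $[a,b]$ is used. The mapping $f$ is metrically differentiable at $x$ if $md(f,x)$ exists and $\|f(y)-f(z)\|-md(f,x)|y-z|=o(|y-x|+|z-x|)$ as $(y,z)\to(x,x)$ with $y,z\in[a,b]$. Symmetric porosity: for $M\subset\mathbb{R}$, $x\in M$, $R>0$, let $S\gamma(x,R,M)$ be the supremum of all $r>0$ for which there exists $z\in\mathbb{R}$ with $B(z,r)\cup B(2x-z,r)\subset B(x,R)\setminus M$, where $B(z,r)=(z-r,z+r)$ (the supremum is $0$ if there is no such $r$). The symmetric upper porosity of $M$ at $x$ is $S\overline{p}(M,x)=2\limsup_{R\to0+}S\gamma(x,R,M)/R$. The set $M$ is symmetrically porous if $S\overline{p}(M,x)>0$ for all $x\in M$. A set is $\sigma$-symmetrically porous if it is a countable union of symmetrically porous sets. *)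

(* Defs.v *)
From mathcomp Require Import all_boot all_order all_algebra.
From mathcomp Require Import all_classical all_reals all_analysis.

Set Implicit Arguments.
Unset Strict Implicit.
Unset Printing Implicit Defensive.

Import Order.TTheory GRing.Theory Num.Theory.
Import numFieldNormedType.Exports.

Local Open Scope classical_set_scope.
Local Open Scope ring_scope.

(* A map on [a, b] is represented by a total f : R -> X; the notions below
   depend only on its values on [a, b]. *)
Section MetricDerivative.
Context {R : realType} {X : normedModType R}.
Implicit Types (a b x m : R) (f : R -> X).

Definition is_mdr f x m : Prop :=
  `|f (x + t) - f x| / t @[t --> 0^'+] --> m.

Definition is_mdl f x m : Prop :=
  `|f (x - t) - f x| / t @[t --> 0^'+] --> m.

(* For x in [a, b] with a < b: both one-sided limits at interior points, only
   the one taken inside [a, b] at an endpoint. *)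
Definition is_md a b f x m : Prop :=
  (x < b -> is_mdr f x m) /\ (a < x -> is_mdl f x m).

Definition ex_md a b f x : Prop := exists m, is_md a b f x m.

(* The value is meaningful only when ex_md a b f x holds. *)
Definition md a b f x : R := xget 0 [set m | is_md a b f x m].

Definition metrically_differentiable a b f x : Prop :=
  ex_md a b f x /\
  (fun p : R * R => `|f p.1 - f p.2| - md a b f x * `|p.1 - p.2| : R^o)
    =o_ (within (`[a, b] `*` `[a, b]) (nbhs (x, x)))
  (fun p : R * R => `|p.1 - x| + `|p.2 - x| : R^o).

End MetricDerivative.

Section SymmetricPorosity.
Context {R : realType}.
Implicit Types (M : set R) (x r : R).

(* sup set0 = 0, and the set is bounded above by r. *)
Definition sym_gamma x r M : R :=
  sup [set s | 0 < s /\
    exists z, ball z s `|` ball (2 * x - z) s `<=` ball x r `\` M].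

Definition sym_upper_porosity M x : \bar R :=
  (2%:E * limf_esup (fun r => (sym_gamma x r M / r)%:E) 0^'+)%E.

Definition symmetrically_porous M : Prop :=
  forall x, M x -> (0 < sym_upper_porosity M x)%E.

Definition sigma_symmetrically_porous M : Prop :=
  exists P : (set R)^nat,
    (forall n, symmetrically_porous (P n)) /\ M = \bigcup_n P n.

End SymmetricPorosity.

(* Main.v *)
Require Import Defs.
From mathcomp Require Import all_boot all_order all_algebra.
From mathcomp Require Import all_classical all_reals all_analysis.
From mathcomp Require Import lra.

Import Order.TTheory GRing.Theory Num.Theory.
Import numFieldNormedType.Exports.

Local Open Scope classical_set_scope.
Local Open Scope ring_scope.

(** Write m for the metric derivative.  By continuity of m, f is Lipschitz near
    x with constant arbitrarily close to m(x), so metric differentiability at x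
    can only fail through a lower bound for points on opposite sides of x, and
    moving the nearer of the two points away from x turns such a failure into
    |f(x+t) - f(x-t)| <= (2m(x) - e)t for a fixed e > 0 and arbitrarily small
    t > 0.  Cut the exceptional set into countably many pieces on which e is
    fixed and |f(y) - f(z)| >= (m(y) - e/8)|y - z| whenever |z - y| < 1/n.  A
    point y of the same piece close to x + t would make |f(y) - f(x-t)| nearly
    2m(x)t, which is impossible, and similarly near x - t: the piece has
    symmetric holes around x + t and x - t of size proportional to t. *)

(** * From pointwise to global Lipschitz bounds *)

(** Continuous induction: let [S] collect the [s] up to which the bound from [c] holds. The local
    estimate at [sup S] first puts [sup S] into [S], then extends the bound beyond it unless
    [sup S = d]. *)
Lemma local_lipschitz_on_itv (R : realType) (X : normedModType R)
    (f : R -> X) (K c d : R) : c <= d ->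
  (forall y, c <= y <= d -> exists2 h, 0 < h &
     forall z, c <= z <= d -> `|z - y| < h -> `|f z - f y| <= K * `|z - y|) ->
  `|f d - f c| <= K * (d - c).
Proof.
move=> cd loc.
pose S := [set s | c <= s <= d /\ `|f s - f c| <= K * (s - c)].
have Sc : S c by split; [lra | rewrite !subrr normr0 mulr0].
have ubS : ubound S d by move=> s [/andP[]].
have supS : has_sup S by split; [exists c | exists d].
have cs : c <= sup S by apply: ub_le_sup => //; exists d.
have sd : sup S <= d by apply: ge_sup => //; exists c.
have csd : c <= sup S <= d by rewrite cs sd.
have [h h0 hloc] := loc _ csd.
have [s [/andP[cs' sd'] Ss] lts] := sup_adherent h0 supS.
have sles : s <= sup S by apply: ub_le_sup; [exists d | split=> //; apply/andP].
have ssup : `|f (sup S) - f c| <= K * (sup S - c).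
  have := hloc s; rewrite cs' sd' (distrC s).
  rewrite (ger0_norm (x := sup S - s)); last lra.
  move=> /(_ isT) H; have {}H : `|f s - f (sup S)| <= K * (sup S - s).
    by apply: H; lra.
  have := ler_distD (f s) (f (sup S)) (f c).
  rewrite (distrC (f (sup S)) (f s)); lra.
move: sd; rewrite le_eqVlt => /predU1P[sE|sd1]; first by rewrite sE in ssup.
pose z := Num.min d (sup S + h / 2).
have [zd zs zh] : [/\ z <= d, sup S < z & z <= sup S + h / 2].
  by rewrite /z; split; rewrite ?ge_min ?lt_min; lra.
have : z <= sup S.
  apply: ub_le_sup; first by exists d.
  split; first lra.
  have := hloc z; rewrite (ger0_norm (x := z - sup S)); last lra.
  have czd : c <= z <= d by lra.
  move=> /(_ czd) H; have {}H : `|f z - f (sup S)| <= K * (z - sup S).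
    by apply: H; lra.
  have := ler_distD (f (sup S)) (f z) (f c); lra.
lra.
Qed.

(** * Local estimates from a continuous metric derivative *)

Section ContinuousMetricDerivative.
Variables (R : realType) (X : normedModType R) (a b : R) (f : R -> X).
Hypothesis exmd : forall x, x \in `[a, b] -> ex_md a b f x.
Hypothesis cmd : {within `[a, b], continuous (md a b f)}.

Let m := md a b f.

Lemma md_near x e : a <= x <= b -> 0 < e -> exists2 h, 0 < h &
  forall y, a <= y <= b -> `|y - x| < h ->
    `| `|f y - f x| - m x * `|y - x| | <= e * `|y - x|.
Proof.
move=> xab e0.
have : is_md a b f x (m x) by apply: xgetPex; apply: exmd; rewrite in_itv.
move=> [mr ml].
have near0 (u : R -> X) : `|u t - f x| / t @[t --> 0^'+] --> m x ->
    exists2 h, 0 < h & forall t, 0 < t -> t < h ->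
      `| `|u t - f x| - m x * t | <= e * t.
  move=> /cvgrPdist_le /(_ e e0) [h /= h0 H]; exists h => // t t0 th.
  have {H} := H t; rewrite /ball_/= sub0r normrN gtr0_norm// => /(_ th t0).
  rewrite distrC -(ler_pM2r t0) -[X in _ * X <= _](gtr0_norm t0) -normrM mulrBl.
  by rewrite divfK// gt_eqF.
have [hr hr0 Hr] : exists2 h, 0 < h & forall y, x < y <= b -> y - x < h ->
    `| `|f y - f x| - m x * (y - x) | <= e * (y - x).
  (* At the right endpoint no [y] qualifies, so any radius serves. *)
  have [xb|bx] := ltP x b; last by exists 1 => // y; lra.
  have [h h0 H] := near0 _ (mr xb); exists h => // y yx yh.
  have := H (y - x); rewrite subrKC; apply; lra.
have [hl hl0 Hl] : exists2 h, 0 < h & forall y, a <= y < x -> x - y < h ->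
    `| `|f y - f x| - m x * (x - y) | <= e * (x - y).
  have [ax|xa] := ltP a x; last by exists 1 => // y; lra.
  have [h h0 H] := near0 _ (ml ax); exists h => // y yx yh.
  have := H (x - y); rewrite subKr; apply; lra.
exists (Num.min hr hl); first by rewrite lt_min hr0 hl0.
move=> y yab; rewrite lt_min => /andP[].
have [yx|yx|->] := ltgtP y x.
- by rewrite ltr0_norm ?opprB; [move=> _ ?; apply: Hl; lra | lra].
- by rewrite gtr0_norm; [move=> ? _; apply: Hr; lra | lra].
- by rewrite !subrr !normr0 !mulr0 subrr normr0.
Qed.

Lemma md_continuous_near x e : a <= x <= b -> 0 < e -> exists2 h, 0 < h &
  forall y, a <= y <= b -> `|y - x| < h -> `|m y - m x| < e.
Proof.
move=> xab e0; have xI : [set` `[a, b]] x by rewrite /= in_itv.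
have /cvgrPdist_lt/(_ e e0) := (@subspace_continuousP _ _ _ _).1 cmd x xI.
rewrite near_withinE => -[h /= h0 H]; exists h => // y yab yx.
by rewrite distrC; apply: H; rewrite /ball_ /= ?in_itv// distrC.
Qed.

(** Half of [e] pays for the variation of [m] near [x], half for the error in [md_near] at each
    intermediate point [w]. The resulting bounds only compare points with [w], and
    [local_lipschitz_on_itv] glues them. *)
Lemma md_lipschitz_near x e : a <= x <= b -> 0 < e -> exists2 h, 0 < h &
  forall y z, a <= y <= b -> a <= z <= b -> `|y - x| < h -> `|z - x| < h ->
    `|f y - f z| <= (m x + e) * `|y - z|.
Proof.
move=> xab e0; have e20 : 0 < e / 2 by lra.
have [h h0 H] := md_continuous_near _ _ xab e20; exists h => //.
have main y z : a <= z <= b -> a <= y <= b -> `|z - x| < h -> `|y - x| < h ->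
    z <= y -> `|f y - f z| <= (m x + e) * (y - z).
  move=> zab yab; rewrite !ltr_distl => zx yx zy.
  apply: local_lipschitz_on_itv => // w wzy.
  have wab : a <= w <= b by lra.
  have [k k0 K] := md_near _ _ wab e20; exists k => // v vzy vw.
  have := K v ltac:(lra) vw; rewrite ler_distl => /andP[_ Kv].
  have := H w wab; rewrite !ltr_distl => /(_ ltac:(lra)) mw.
  apply: (le_trans Kv); rewrite -mulrDl ler_wpM2r//; lra.
move=> y z yab zab yx zx; have [zy|yz] := leP z y.
- by rewrite (ger0_norm (x := y - z)) ?subr_ge0//; exact: main.
- rewrite distrC (distrC y) (gtr0_norm (x := z - y)) ?subr_gt0//.
  by apply: main => //; exact: ltW.
Qed.

Lemma metrically_differentiable_sym x : a <= x <= b ->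
  (forall e, 0 < e -> exists2 h, 0 < h & forall t, 0 < t -> t < h ->
     a <= x - t -> x + t <= b ->
     (2 * m x - e) * t <= `|f (x + t) - f (x - t)|) ->
  metrically_differentiable a b f x.
Proof.
move=> xab sym; split; first by apply: exmd; rewrite in_itv.
apply/eqoP => e e0; have e20 : 0 < e / 2 by lra.
have [h1 h10 H1] := md_near _ _ xab e20.
have [h2 h20 H2] := md_lipschitz_near _ _ xab e20.
have [h3 h30 H3] := sym _ e20.
(* Reflected points must stay in [[a, b]]. If [x] is an endpoint, no two points lie strictly on
   opposite sides of it, so any radius serves. *)
have [h4 h40 H4] : exists2 h, 0 < h &
    forall t, t < h -> a < x < b -> a <= x - t /\ x + t <= b.
  have [xI|xI] := boolP (a < x < b); last by exists 1.
  exists (Num.min (x - a) (b - x)); first by rewrite lt_min; lra.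
  by move=> t; rewrite lt_min; lra.
have [h h0 [k1 k2 k3 k4]] :
    exists2 h, 0 < h & [/\ h <= h1, h <= h2, h <= h3 & h <= h4].
  exists (Num.min (Num.min h1 h2) (Num.min h3 h4)).
    by rewrite !lt_min h10 h20 h30 h40.
  by split; rewrite !ge_min lexx ?orbT.
have main y z : a <= z <= b -> a <= y <= b -> `|y - x| < h -> `|z - x| < h ->
    z <= y ->
    m x * (y - z) - e * (`|y - x| + `|z - x|) <= `|f y - f z|.
  move=> zab yab yx zx zy.
  have := H1 y yab ltac:(lra); have := H1 z zab ltac:(lra).
  rewrite !ler_distl.
  have Dy := ler_distD (f z) (f y) (f x).
  have Dz := ler_distD (f y) (f z) (f x).
  rewrite (distrC (f z) (f y)) in Dz.
  (* On one side of [x], the triangle inequality through [f x] suffices. *)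
  have [xz|zltx] := leP x z.
    rewrite !ger0_norm; [nra|lra|lra].
  have [yx'|xlty] := leP y x.
    rewrite !ler0_norm; [nra|lra|lra].
  move=> _ _; move: yx zx.
  rewrite (gtr0_norm (x := y - x)) ?subr_gt0//.
  rewrite (ltr0_norm (x := z - x)) ?subr_lt0//.
  move=> yx zx; have xI : a < x < b by lra.
  (* The farther point and its reflection form a symmetric pair; the nearer point is joined to that
     reflection by the Lipschitz bound. *)
  have [yz|zy'] := leP (y - x) (x - z).
  - pose t := x - z.
    have [at1 tb] := H4 t ltac:(rewrite /t; lra) xI.
    have := H3 t ltac:(rewrite /t; lra) ltac:(rewrite /t; lra) at1 tb.
    have := H2 (x + t) y ltac:(rewrite /t in at1 tb *; lra) yab.
    rewrite -[x - t]/(x - (x - z)) subKr addrAC subrr add0r.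
    rewrite (ger0_norm (x := t)) ?(gtr0_norm (x := y - x))
      ?(ger0_norm (x := x + t - y)); [|rewrite /t; lra..].
    move=> /(_ ltac:(rewrite /t; lra) ltac:(lra)).
    have := ler_distD (f y) (f (x + t)) (f z).
    rewrite /t; nra.
  - pose t := y - x.
    have [at1 tb] := H4 t ltac:(rewrite /t; lra) xI.
    have := H3 t ltac:(rewrite /t; lra) ltac:(rewrite /t; lra) at1 tb.
    have := H2 z (x - t) zab ltac:(rewrite /t in at1 tb *; lra).
    rewrite -[x + t]/(x + (y - x)) subrKC addrAC subrr add0r normrN.
    rewrite (ger0_norm (x := t)) ?(ltr0_norm (x := z - x))
      ?(ger0_norm (x := z - (x - t))); [|rewrite /t; lra..].
    move=> /(_ ltac:(lra) ltac:(rewrite /t; lra)).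
    have := ler_distD (f z) (f y) (f (x - t)).
    rewrite /t; nra.
have box (y z : R) : a <= y <= b -> a <= z <= b -> `|y - x| < h ->
    `|z - x| < h -> `| `|f y - f z| - m x * `|y - z| | <=
      e * `| `|y - x| + `|z - x| |.
  move=> yab zab yx zx.
  rewrite (ger0_norm (x := `|y - x| + `|z - x|)) ?addr_ge0//.
  have := H2 y z yab zab ltac:(lra) ltac:(lra) => up.
  have tri := ler_distD x y z; rewrite (distrC x) in tri.
  have lo : m x * `|y - z| - e * (`|y - x| + `|z - x|) <= `|f y - f z|.
    have [zy|yz] := leP z y.
      by rewrite (ger0_norm (x := y - z)) ?subr_ge0//; exact: main.
    rewrite (distrC y) (gtr0_norm (x := z - y)) ?subr_gt0// (distrC (f y)).
    by rewrite (addrC `|y - x|); apply: main => //; exact: ltW.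
  by rewrite ler_distl; have := normr_ge0 (y - z); nra.
rewrite near_withinE; exists (ball x h, ball x h).
  by split; exact: nbhsx_ballx.
move=> [y z] [/=]; rewrite /ball/= => yx zx [].
by rewrite /= !in_itv/= => yab zab; apply: box => //; rewrite distrC.
Qed.

End ContinuousMetricDerivative.

(** * Porosity from symmetric holes *)

Lemma sym_gamma_ge (R : realType) (M : set R) (x r s z : R) : 0 < s ->
  ball z s `|` ball (2 * x - z) s `<=` ball x r `\` M -> s <= sym_gamma x r M.
Proof.
move=> s0 H; apply: ub_le_sup; last by split=> //; exists z.
(* The points [w] and [w + u / 2] both lie within [r] of [x], so [u < 4 * r]. *)
exists (4 * r) => u [u0 [w W]].
have /W[+ _] : (ball w u `|` ball (2 * x - w) u) w by left; exact: ballxx.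
have /W[+ _] : (ball w u `|` ball (2 * x - w) u) (w + u / 2).
  by left; rewrite /ball/= opprD addNKr normrN gtr0_norm; lra.
by rewrite /ball/= !ltr_distl; lra.
Qed.

(** As [c <= 1], the holes around [x + t] and [x - t] fit into the ball of radius [2 * t], so the
    quotient is at least [c / 2] at arbitrarily small radii. *)
Lemma sym_upper_porosity_gt0 (R : realType) (M : set R) (x c : R) :
  0 < c -> c <= 1 ->
  (forall h, 0 < h -> exists t, [/\ 0 < t, t < h &
     forall y, M y ->
       `|y - (x + t)| < c * t \/ `|y - (x - t)| < c * t -> False]) ->
  (0 < sym_upper_porosity M x)%E.
Proof.
move=> c0 c1 holes; apply: mule_gt0 => //.
apply: (@lt_le_trans _ _ (c / 2)%:E); first by rewrite lte_fin; lra.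
apply: le_ereal_inf_tmp => _ [V [h /= h0 HV] <-].
have [t [t0 th Ht]] := holes (h / 2) ltac:(lra).
apply: le_ereal_sup_tmp => //; exists (sym_gamma x (2 * t) M / (2 * t))%:E.
  exists (2 * t) => //; apply: HV => /=; last lra.
  by rewrite sub0r normrN gtr0_norm; lra.
rewrite lee_fin ler_pdivlMr; last lra.
have -> : c / 2 * (2 * t) = c * t by lra.
apply: (@sym_gamma_ge _ _ _ _ _ (x + t)); first exact: mulr_gt0.
have -> : 2 * x - (x + t) = x - t by lra.
move=> y; rewrite /ball/= => xy; split.
  by case: xy; rewrite !ltr_distl; nra.
by move=> My; apply: (Ht y My); case: xy; rewrite distrC; [left|right].
Qed.

(* With [p], [q] the points [x + t], [x - t] in some order: [w = |y - p|],
   [v = |y - q|], [F = |f y - f q|], [G = |f y - f p|], [H = |f p - f q|]. *)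
Lemma no_point_near_bad_pair (R : realFieldType)
    (mx my e c t w v F G H : R) : 0 < e -> 0 < t -> 0 <= w -> w < c * t ->
  c * (2 * `|mx| + 3 * (e / 8)) <= e / 4 ->
  2 * t - w <= v -> v <= 2 * t + w -> 0 <= v -> mx - e / 8 <= my ->
  (my - e / 8) * v <= F -> F <= G + H ->
  G <= (mx + e / 8) * w -> H <= (2 * mx - e) * t -> False.
Proof.
move=> e0 t0 w0 wct cM lv uv v0 mxy low tri up bad.
have K0 : 0 <= 2 * `|mx| + 3 * (e / 8) by have := normr_ge0 mx; lra.
(* Once the terms [2 * mx * t] cancel, the hypotheses leave [e / 2 * t <= w * (2 * |mx| + 3 * (e /
   8))], which contradicts [w1]. *)
have w1 : w * (2 * `|mx| + 3 * (e / 8)) <= e / 4 * t.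
  apply: (@le_trans _ _ (c * t * (2 * `|mx| + 3 * (e / 8)))).
    by rewrite ler_wpM2r// ltW.
  by rewrite mulrAC ler_wpM2r// ltW.
have m1 : mx * w <= `|mx| * w by rewrite ler_wpM2r// ler_norm.
have m2 : mx * (2 * t - v) <= `|mx| * w.
  apply: (le_trans (ler_norm _)); rewrite normrM ler_wpM2l//.
  by rewrite ler_norml; lra.
have m3 : (mx - e / 8 - e / 8) * v <= (my - e / 8) * v.
  by rewrite ler_wpM2r//; lra.
have m4 : e * v <= e * (2 * t + w) by rewrite ler_wpM2l// ltW.
have et := mulr_gt0 e0 t0.
lra.
Qed.

(** * Decomposition into symmetrically porous pieces *)

Theorem theorem4p7 (R : realType) (X : completeNormedModType R)
    (a b : R) (f : R -> X) (ltab : a < b)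
    (exmd : forall x, x \in `[a, b] -> ex_md a b f x)
    (cmd : {within `[a, b], continuous (md a b f)}) :
  sigma_symmetrically_porous
    [set x | x \in `[a, b] /\ ~ metrically_differentiable a b f x].
Proof.
set B := [set x | _].
pose m := md a b f.
pose ep (k : nat) : R := k.+1%:R^-1.
have ep0 k : 0 < ep k by rewrite invr_gt0.
have epsmall (e : R) : 0 < e -> exists k, ep k < e.
  move=> e0; exists (Num.truncn e^-1); rewrite /ep.
  by rewrite invf_plt ?posrE// truncnS_gt.
pose bad (k : nat) (x : R) :=
  forall h : R, 0 < h -> exists t : R,
    [/\ 0 < t, t < h, a <= x - t, x + t <= b &
      `|f (x + t) - f (x - t)| <= (2 * m x - ep k) * t].
pose unif (k n : nat) (x : R) := forall y, a <= y <= b -> `|y - x| < ep n ->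
  (m x - ep k / 8) * `|y - x| <= `|f y - f x|.
pose Q (k n : nat) := [set x | B x /\ bad k x /\ unif k n x].
have BQ x : B x -> exists k n, Q k n x.
  move=> Bx; have [] := Bx; rewrite in_itv/= => xab nmd.
  have [k badk] : exists k, bad k x.
    apply: contrapT => nbad; apply: nmd.
    apply: metrically_differentiable_sym => // e e0.
    have [k ke] := epsmall e e0; apply: contrapT => nh.
    apply: nbad; exists k => h h0; apply: contrapT => nt.
    apply: nh; exists h => // t t0 th at1 tb; rewrite leNgt; apply/negP => lt.
    apply: nt; exists t; split=> //; apply: (le_trans (ltW lt)).
    by rewrite ler_wpM2r ?ltW//; rewrite /m; lra.
  have ek0 : 0 < ep k / 8 by have := ep0 k; lra.
  have [h h0 H] := @md_near _ _ _ _ _ exmd _ _ xab ek0.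
  have [n nh] := epsmall h h0.
  exists k, n; split=> //; split=> // y yab yx.
  have := H y yab ltac:(lra); rewrite ler_distl /m; lra.
(* Badness at [x] supplies the pairs [x + t], [x - t]; uniformity is applied at the other points [y]
   of the piece. *)
have porousQ k n : symmetrically_porous (Q k n).
  move=> x [[xin _] [badx _]]; move: xin; rewrite in_itv/= => xab.
  have := ep0 k; set e := ep k => e0.
  pose d := e / 8; have d0 : 0 < d by rewrite /d; lra.
  have M0 := normr_ge0 (m x).
  have [c [c0 c1 cM]] : exists c, [/\ 0 < c, c <= 1/2 &
      c * (2 * `|m x| + 3 * d) <= e / 4].
    have D0 : 0 < 8 * (`|m x| + e) by lra.
    exists (e / (8 * (`|m x| + e))); split.
    - exact: divr_gt0.
    - by rewrite ler_pdivrMr//; lra.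
    - by rewrite mulrAC ler_pdivrMr// /d; nra.
  have [h1 h10 H1] := @md_continuous_near _ _ _ _ _ cmd _ _ xab d0.
  have [h2 h20 H2] := @md_lipschitz_near _ _ _ _ _ exmd cmd _ _ xab d0.
  apply: (@sym_upper_porosity_gt0 _ _ _ c) => //; first lra.
  move=> h h0.
  (* With [c <= 1/2], a point [y] in a hole is within [3/2 * t] of [x] and [5/2 * t] of the opposite
     point; hence the factors 2 and 3. *)
  have [g g0 [g1 g2 g3 g4]] :
    exists2 g, 0 < g & [/\ g <= h, g <= h1 / 2, g <= h2 / 2 & g <= ep n / 3].
    exists (Num.min (Num.min h (h1 / 2)) (Num.min (h2 / 2) (ep n / 3))).
      by rewrite !lt_min h0 !divr_gt0.
    by split; rewrite !ge_min lexx ?orbT.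
  have [t [t0 tg at1 tb tbad]] := badx g g0.
  exists t; split=> //; first exact: lt_le_trans g1.
  have hole y p q : Q k n y -> a <= p <= b -> a <= q <= b ->
      `|p - x| <= t -> `|q - x| <= t -> `|p - q| = 2 * t ->
      `|f p - f q| <= (2 * m x - e) * t -> `|y - p| < c * t -> False.
    move=> [[yin _] [_ unify]] pab qab px qx pq fpq yp.
    move: yin; rewrite in_itv/= => yab.
    have ct : c * t <= t / 2 by nra.
    have Dyx := ler_distD p y x.
    have my := H1 y yab ltac:(lra); rewrite ltr_distl in my.
    have {}my : m x - e / 8 <= m y by case/andP: my => /ltW.
    have fyp := H2 y p yab pab ltac:(lra) ltac:(lra).
    have Dyq := ler_distD p y q.
    have Dpq := ler_distD y p q; rewrite (distrC p y) in Dpq.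
    have := unify q qab; rewrite (distrC q) (distrC (f q)) => /(_ ltac:(lra)).
    have Df := ler_distD (f p) (f y) (f q).
    move=> low; rewrite pq in Dyq Dpq.
    apply: (@no_point_near_bad_pair _ (m x) (m y) e c t `|y - p| `|y - q|
      `|f y - f q| `|f y - f p| `|f p - f q|) => //.
    - by rewrite lerBlDl.
    - by rewrite [leRHS]addrC.
  have pt : `|x + t - x| <= t by rewrite addrAC subrr add0r gtr0_norm.
  have qt : `|x - t - x| <= t by rewrite addrAC subrr add0r normrN gtr0_norm.
  have pqt : `|x + t - (x - t)| = 2 * t by rewrite ger0_norm; lra.
  move=> y Qy [yp|yp].
  - by apply: (hole y (x + t) (x - t)) => //; lra.
  - by apply: (hole y (x - t) (x + t)) => //; rewrite 1?distrC//; lra.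
(* Pairs [(k, n)] are enumerated by their codes; other indices get the empty set, which is vacuously
   porous. *)
exists (fun i => if unpickle i is Some (k, n) then Q k n else set0); split.
  by move=> i; case: unpickle => [[k n]|]; [exact: porousQ | move=> x].
apply/seteqP; split=> x.
- by move=> /BQ[k [n Qx]]; exists (pickle (k, n)) => //=; rewrite pickleK.
- by move=> [i _]; case: unpickle => [[k n] []|].
Qed.
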